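(* Suppose the regularity conditions (R), the terminal conditions (T), the open-loop stability condition (S) and the simplifying conditions (E) stated in the context hold. Then there exist constants $c_{\mathbb{X},1},c_{\mathbb{X},2},c_{\mathbb{X},3}\ge0$ such that for any initial condition $x_0\in\mathbb{R}^n$, any weight $\lambda>0$, any disturbances $w(k)\in\mathbb{R}^n$, $k\in\mathbb{I}_{\ge0}$, and any time $T\in\mathbb{I}_{\ge0}$, the closed-loop system $x(k+1)=f(x(k),\pi_{\mathrm{slack}}(x(k)))+w(k)$, $x(0)=x_0$, satisfies $$\sum_{k=0}^{T-1}\|x(k)\|_{\mathbb{X}}^2\le c_{\mathbb{X},1}\|x_0\|_{\mathbb{X}_N}^2+\frac{c_{\mathbb{X},2}}{\lambda}+c_{\mathbb{X},3}\sum_{k=0}^{T-1}\|w(k)\|^2 .$$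
   Context: Notation. $\|\cdot\|$ is the Euclidean norm; for a positive definite matrix $Q$, $\|x\|_Q=\sqrt{x^\top Qx}$; for a set $\mathcal{A}\subset\mathbb{R}^n$, $\|x\|_{\mathcal{A}}=\inf_{s\in\mathcal{A}}\|x-s\|$. $\mathbb{I}_{[a,b]}$ (resp. $\mathbb{I}_{\ge a}$) is the set of integers in $[a,b]$ (resp. $\ge a$). $\mathcal{K}_\infty$: continuous, strictly increasing, radially unbounded functions $\alpha:\mathbb{R}_{\ge0}\to\mathbb{R}_{\ge0}$ with $\alpha(0)=0$. System. $x(k+1)=f(x(k),u(k))+w(k)$, $x(0)=x_0\in\mathbb{R}^n$, with inputs $u(k)\in\mathbb{U}\subseteq\mathbb{R}^m$ and arbitrary disturbances $w(k)\in\mathbb{R}^n$. $\ell:\mathbb{R}^n\times\mathbb{U}\to\mathbb{R}_{\ge0}$ is a stage cost and $\mathbb{X}\subseteq\mathbb{R}^n$ is a closed state constraint set. (R) Regularity: there is $\alpha_\ell\in\mathcal{K}_\infty$ with $\ell(x,u)\ge\alpha_\ell(\|x\|+\|u\|)$ for all $(x,u)\in\mathbb{R}^n\times\mathbb{U}$; $f(0,0)=0$, $\ell(0,0)=0$, $0\in\mathrm{int}(\mathbb{U})$, $0\in\mathrm{int}(\mathbb{X})$; $f,\ell$ are continuous; $\mathbb{U}$ is compact. Nominal MPC. Fix $N\in\mathbb{I}_{\ge1}$. For $x\in\mathbb{R}^n$ and $\mathbf{u}=(\mathbf{u}_0,\dots,\mathbf{u}_{N-1})\in\mathbb{U}^N$,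 $x_{\mathbf{u}}(k,x)$ is the state after $k$ steps of the undisturbed system ($w\equiv0$) started at $x_{\mathbf{u}}(0,x)=x$. Let $V_{\mathrm{f}}:\mathbb{R}^n\to\mathbb{R}_{\ge0}$ be continuous, $\mathbb{X}_{\mathrm{f}}\subseteq\mathbb{X}$ closed, and $$\mathcal{J}_N(x,\mathbf{u})=\sum_{k=0}^{N-1}\ell(x_{\mathbf{u}}(k,x),\mathbf{u}_k)+V_{\mathrm{f}}(x_{\mathbf{u}}(N,x)).$$ $\mathbb{X}_N\subseteq\mathbb{X}$ is the set of $x$ for which there is $\mathbf{u}\in\mathbb{U}^N$ with $x_{\mathbf{u}}(k,x)\in\mathbb{X}$ for $k\in\mathbb{I}_{[0,N-1]}$ and $x_{\mathbf{u}}(N,x)\in\mathbb{X}_{\mathrm{f}}$. (T) Terminal conditions: there are $k_{\mathrm{f}}:\mathbb{X}_{\mathrm{f}}\to\mathbb{U}$ and $\alpha_{\mathrm{f}}\in\mathcal{K}_\infty$ such that for every $x\in\mathbb{X}_{\mathrm{f}}$, with $u=k_{\mathrm{f}}(x)$, $x^+=f(x,u)$: $V_{\mathrm{f}}(x^+)\le V_{\mathrm{f}}(x)-\ell(x,u)$; $(x,u)\in\mathbb{X}\times\mathbb{U}$; $x^+\in\mathbb{X}_{\mathrm{f}}$; $V_{\mathrm{f}}(x)\le\alpha_{\mathrm{f}}(\|x\|)$. Moreover $0\in\mathrm{int}(\mathbb{X}_{\mathrm{f}})$ and $\mathbb{X}_N$ is compact. (S) Open-loop stability: $V_\delta:\mathbb{R}^n\times\mathbb{R}^n\to\mathbb{R}_{\ge0}$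 is continuous and there are $\alpha_{\delta,1},\dots,\alpha_{\delta,4}\in\mathcal{K}_\infty$ such that for all $x,z,w\in\mathbb{R}^n$, $u\in\mathbb{U}$: $\alpha_{\delta,1}(\|x-z\|)\le V_\delta(x,z)\le\alpha_{\delta,2}(\|x-z\|)$ and $V_\delta(f(x,u)+w,f(z,u))-V_\delta(x,z)\le-\alpha_{\delta,3}(\|x-z\|)+\alpha_{\delta,4}(\|w\|)$. (E) Simplifying conditions: (a) $\alpha_\ell(r)=c_\ell r^2$ and $\alpha_{\mathrm{f}}(r)=c_{\mathrm{f}}r^2$ are quadratic; (b) $\ell(x,u)=\|x\|_Q^2+\|u\|_R^2$ with positive definite matrices $Q,R$; (c) $\alpha_{\delta,i}(r)=c_{\delta,i}r^2$ are quadratic, $i\in\mathbb{I}_{[1,4]}$. Relaxed MPC. For a weight $\lambda>0$, $$V_{\mathrm{slack}}(x)=\min_{\bar{x}\in\mathbb{R}^n,\,\mathbf{u}\in\mathbb{U}^N}\mathcal{J}_N(\bar{x},\mathbf{u})+\lambda V_\delta(x,\bar{x})\quad\text{s.t. }x_{\mathbf{u}}(k,\bar{x})\in\mathbb{X},\ k\in\mathbb{I}_{[0,N-1]},\ x_{\mathbf{u}}(N,\bar{x})\in\mathbb{X}_{\mathrm{f}},$$ with minimizer denoted $(\bar{x}^*_{\mathrm{slack}}(x),\mathbf{u}^*_{\mathrm{slack}}(x))$, and $\pi_{\mathrm{slack}}(x)=\mathbf{u}^*_{\mathrm{slack},0}(x)\in\mathbb{U}$ is its first input (which depends on $\lambda$).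 *)

(* Defs.v *)
From HB Require Import structures.
From mathcomp Require Import all_boot all_order all_algebra.
From mathcomp Require Import all_classical all_reals all_analysis.
Set Implicit Arguments.
Unset Strict Implicit.
Unset Printing Implicit Defensive.
Import Order.TTheory GRing.Theory Num.Theory.
Import numFieldNormedType.Exports.
Local Open Scope classical_set_scope.
Local Open Scope ring_scope.

(* R^n is the type 'cV[R]_n of column vectors.
   Its library norm is the sup norm, so the Euclidean norm is defined here;
   both induce the library topology used for continuous, compact, closed and
   interior. *)

Section Norms.
Variables (R : realType) (n : nat).

Definition enorm (x : 'cV[R]_n) : R := Num.sqrt (\sum_(i < n) x i 0 ^+ 2).

(* Only the symmetric part of Q matters to wnorm, so symmetry is not imposed. *)
Definition posdef (Q : 'M[R]_n) : Prop :=
  forall x : 'cV[R]_n, x != 0 -> 0 < (x^T *m Q *m x) 0 0.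

Definition wnorm (Q : 'M[R]_n) (x : 'cV[R]_n) : R :=
  Num.sqrt ((x^T *m Q *m x) 0 0).

Definition set_dist (A : set 'cV[R]_n) (x : 'cV[R]_n) : R :=
  inf [set enorm (x - s) | s in A].

End Norms.

Section ComparisonFunctions.
Variable R : realType.

(* A function on [0, +oo) is represented by a total function whose values at
   negative arguments are irrelevant. *)
Definition classKinf (a : R -> R) : Prop :=
  [/\ {within [set r : R | 0 <= r], continuous a},
      (forall r s, 0 <= r -> r < s -> a r < a s),
      a 0 = 0
    & a r @[r --> +oo] --> +oo].

Definition is_quadratic (a : R -> R) : Prop :=
  exists c : R, forall r, 0 <= r -> a r = c * r ^+ 2.

End ComparisonFunctions.

Section MPC.
Variables (R : realType) (n m : nat).
Variable f : 'cV[R]_n -> 'cV[R]_m -> 'cV[R]_n.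
Variable ell : 'cV[R]_n -> 'cV[R]_m -> R.
Variables (U : set 'cV[R]_m) (X : set 'cV[R]_n).

(* f and ell matter only on R^n x U, and their continuity is for the subspace
   topology there. *)
Record regularity (al : R -> R) : Prop := Regularity {
  reg_Kinf : classKinf al;
  reg_lower : forall x u, U u -> al (enorm x + enorm u) <= ell x u;
  reg_f0 : f 0 0 = 0;
  reg_ell0 : ell 0 0 = 0;
  reg_U0 : U° 0;
  reg_X0 : X° 0;
  reg_f_cont : {within [set p : 'cV[R]_n * 'cV[R]_m | U p.2],
                  continuous (fun p => f p.1 p.2)};
  reg_ell_cont : {within [set p : 'cV[R]_n * 'cV[R]_m | U p.2],
                    continuous (fun p => ell p.1 p.2)};
  reg_U_compact : compact U }.

(* The state after k undisturbed steps; only k <= size u is ever used. *)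
Fixpoint nominal (u : seq 'cV[R]_m) (k : nat) (x : 'cV[R]_n) : 'cV[R]_n :=
  if k is k'.+1 then f (nominal u k' x) u`_k' else x.

Variable N : nat.
Variables (Vf : 'cV[R]_n -> R) (Xf : set 'cV[R]_n).

Definition nominal_cost (x : 'cV[R]_n) (u : N.-tuple 'cV[R]_m) : R :=
  \sum_(k < N) ell (nominal u k x) u`_k + Vf (nominal u N x).

Definition admissible (x : 'cV[R]_n) (u : N.-tuple 'cV[R]_m) : Prop :=
  [/\ (forall k : 'I_N, U u`_k),
      (forall k : 'I_N, X (nominal u k x))
    & Xf (nominal u N x)].

Definition feasible_set : set 'cV[R]_n :=
  [set x | exists u : N.-tuple 'cV[R]_m, admissible x u].

Record terminal_conditions (af : R -> R) : Prop := TerminalConditions {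
  term_Kinf : classKinf af;
  term_law : exists kf : 'cV[R]_n -> 'cV[R]_m, forall x, Xf x ->
    [/\ Vf (f x (kf x)) <= Vf x - ell x (kf x),
        X x /\ U (kf x),
        Xf (f x (kf x))
      & Vf x <= af (enorm x)];
  term_int : Xf° 0;
  term_compact : compact feasible_set }.

Variable Vd : 'cV[R]_n -> 'cV[R]_n -> R.

Record open_loop_stability (a1 a2 a3 a4 : R -> R) : Prop :=
  OpenLoopStability {
  ols_ge0 : forall x z, 0 <= Vd x z;
  ols_cont : continuous (fun p : 'cV[R]_n * 'cV[R]_n => Vd p.1 p.2);
  ols_Kinf1 : classKinf a1;
  ols_Kinf2 : classKinf a2;
  ols_Kinf3 : classKinf a3;
  ols_Kinf4 : classKinf a4;
  ols_bounds : forall x z, a1 (enorm (x - z)) <= Vd x z <= a2 (enorm (x - z));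
  ols_decrease : forall x z w u, U u ->
    Vd (f x u + w) (f z u) - Vd x z <= - a3 (enorm (x - z)) + a4 (enorm w) }.

Definition slack_cost (lambda : R) (x xbar : 'cV[R]_n)
    (u : N.-tuple 'cV[R]_m) : R :=
  nominal_cost xbar u + lambda * Vd x xbar.

Definition slack_minimizers (lambda : R) (x : 'cV[R]_n) :
    set ('cV[R]_n * N.-tuple 'cV[R]_m) :=
  [set p | admissible p.1 p.2 /\
    forall xbar u, admissible xbar u ->
      slack_cost lambda x p.1 p.2 <= slack_cost lambda x xbar u].

(* mpc returns, at every state, the first input of some minimizer (minimizers
   need not be unique).  The existence of minimizers is not assumed here: it
   has to be derived from the standing assumptions. *)
Definition slack_policy (lambda : R) (mpc : 'cV[R]_n -> 'cV[R]_m) : Prop :=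
  forall x, slack_minimizers lambda x !=set0 ->
    exists2 p, slack_minimizers lambda x p & mpc x = p.2`_0.

End MPC.

Definition closed_loop (R : realType) (n m : nat)
    (f : 'cV[R]_n -> 'cV[R]_m -> 'cV[R]_n) (mpc : 'cV[R]_n -> 'cV[R]_m)
    (w : nat -> 'cV[R]_n) (x0 : 'cV[R]_n) (x : nat -> 'cV[R]_n) : Prop :=
  x 0%N = x0 /\ forall k, x k.+1 = f (x k) (mpc (x k)) + w k.

(* Main.v *)
Require Import Defs.
From HB Require Import structures.
From mathcomp Require Import all_boot all_order all_algebra.
From mathcomp Require Import all_classical all_reals all_analysis.
From mathcomp Require Import ring lra.
Set Implicit Arguments.
Unset Strict Implicit.
Unset Printing Implicit Defensive.
Import Order.TTheory GRing.Theory Num.Theory.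
Import numFieldNormedType.Exports.
Local Open Scope classical_set_scope.
Local Open Scope ring_scope.

(** The optimal relaxed cost is a Lyapunov function for the constraint
    violation.  Let [(z, u)] be a minimizer at the state [x], so that the
    applied input is the head of [u].  At the successor state
    [x' = f x u_0 + w] the shifted plan, which starts at [f z u_0], follows the
    tail of [u] and ends with the terminal control law, is still admissible.
    Its nominal cost is smaller than that of [(z, u)] by at least
    [ell z u_0 >= 0], and open-loop stability bounds the change of the coupling
    term, whence
    [V x' <= V x - lambda c3 |x - z|^2 + lambda c4 |w|^2].
    The nominal initial state [z] of an admissible plan lies in [X] (the
    horizon is positive), so [|x - z|] is at least the distance from [x] to [X].
    Hence each step pays for the squared violation ([slack_cost_decrease]),
    and the steps telescope along the closed loop ([slack_cost_telescope]).

    It remains to bound [V x0].  Any feasible nominal state [s] gives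
    [V x0 <= J + lambda c2 |x0 - s|^2], where [J] bounds the nominal cost of all
    admissible plans; taking the infimum over [s] yields the distance from [x0]
    to the feasible set, and dividing by [lambda c3] gives the constants
    [c2 / c3], [J / c3] and [c4 / c3].

    Both the bound [J] and the existence of minimizers, without which the
    policy would be unconstrained, come from the compactness of the set of
    admissible plans ([admissible_plans_compact]) and the continuity of the
    costs on it. *)

(** * Quadratic gains and distances *)

(** Strict monotonicity between 0 and 1 makes the coefficient positive. *)
Lemma Kinf_quadratic (R : realType) (a : R -> R) :
  classKinf a -> is_quadratic a ->
  exists2 c, 0 < c & forall r, 0 <= r -> a r = c * r ^+ 2.
Proof.
move=> [_ incr a0 _] [c ac]; exists c => //.
by have := incr _ _ (lexx 0) (@ltr01 R); rewrite a0 ac ?ler01// expr1n mulr1.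
Qed.

Section Distance.
Variables (R : realType) (n : nat).
Implicit Types (A : set 'cV[R]_n) (x s : 'cV[R]_n).

Lemma enorm_ge0 x : 0 <= enorm x.
Proof. exact: sqrtr_ge0. Qed.

Lemma set_dist_le A x s : A s -> set_dist A x <= enorm (x - s).
Proof.
move=> As; apply: ge_inf; last by exists s.
by exists 0 => _ [t _ <-]; exact: enorm_ge0.
Qed.

Lemma set_dist_ge0 A x : 0 <= set_dist A x.
Proof.
have [[s As]|] := pselect (A !=set0).
  apply: lb_le_inf; first by exists (enorm (x - s)), s.
  by move=> _ [t _ <-]; exact: enorm_ge0.
move=> A0; suff -> : A = set0 by rewrite /set_dist image_set0 inf0.
by apply/eqP; apply: contrapT => /negP/set0P.
Qed.

(** The infimum may be taken under the square, even though it need not be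
    attained: the hypothesis makes the square root of [(v - J) / c] a lower
    bound of the distances. *)
Lemma le_set_dist_sqr A x (v J c : R) : A !=set0 -> 0 < c ->
  (forall s, A s -> v <= J + c * enorm (x - s) ^+ 2) ->
  v <= J + c * set_dist A x ^+ 2.
Proof.
move=> [s0 As0] c0 vle; rewrite -lerBlDl -ler_pdivrMl// mulrC.
have [dle|dgt] := leP ((v - J) / c) 0; first exact: le_trans (sqr_ge0 _).
rewrite -(sqr_sqrtr (ltW dgt)) ler_sqr ?nnegrE ?sqrtr_ge0 ?set_dist_ge0//.
apply: lb_le_inf; first by exists (enorm (x - s0)), s0.
move=> _ [s As <-].
rewrite -ler_sqr ?nnegrE ?sqrtr_ge0 ?enorm_ge0// sqr_sqrtr ?(ltW dgt)//.
by rewrite ler_pdivrMr// mulrC lerBlDl; exact: vle.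
Qed.

End Distance.

(** * The shifted plan *)

Section Shift.
Variables (R : realType) (n m : nat).
Variables (f : 'cV[R]_n -> 'cV[R]_m -> 'cV[R]_n) (ell : 'cV[R]_n -> 'cV[R]_m -> R).
Implicit Types (u v : seq 'cV[R]_m) (x : 'cV[R]_n) (a b : 'cV[R]_m).

Lemma eq_nominal u v k x : (forall i, (i < k)%N -> u`_i = v`_i) ->
  nominal f u k x = nominal f v k x.
Proof.
elim: k => //= k IH uv; rewrite uv// IH// => i ik.
exact/uv/(ltn_trans ik).
Qed.

(** Dropping the first input of a plan restarts the same nominal trajectory
    one step later; this is what relates a plan to its shift. *)
Lemma nominal_cons a u k x : nominal f (a :: u) k.+1 x = nominal f u k (f x a).
Proof. by elim: k => //= k ->. Qed.

Lemma nominal_rcons u b k x : (k <= size u)%N ->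
  nominal f (rcons u b) k x = nominal f u k x.
Proof.
move=> ku; apply: eq_nominal => i ik.
by rewrite nth_rcons (leq_trans ik ku).
Qed.

Section Terminal.
Variables (U : set 'cV[R]_m) (X Xf : set 'cV[R]_n) (Vf : 'cV[R]_n -> R).
Variables (N : nat) (a b : 'cV[R]_m) (u : N.-tuple 'cV[R]_m) (x : 'cV[R]_n).
Let xN := nominal f (a :: u) N.+1 x.

(** The plan [a :: u] at [x] is replaced by [rcons u b] at [f x a].  The shifted
    trajectory is the old one without its first state; only the last step,
    from the old terminal state [xN] under the terminal input [b], is new. *)
Lemma admissible_shift : admissible f U X Xf x [tuple of a :: u] ->
  X xN -> U b -> Xf (f xN b) ->
  admissible f U X Xf (f x a) [tuple of rcons u b].
Proof.
move=> [Uu Xu _] XxN Ub XfxN; have su := size_tuple u.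
split=> [k|k|/=].
- rewrite /= nth_rcons su; case: ltngtP => [kN|kN|_]; last exact: Ub.
    exact: (Uu (Ordinal (kN : (k.+1 < N.+1)%N))).
  by have := ltn_ord k; rewrite ltnS leqNgt kN.
- have kN : (k <= N)%N by rewrite -ltnS.
  rewrite [tval _]/= nominal_rcons ?su// -nominal_cons.
  have := kN; rewrite leq_eqVlt => /predU1P[->|{}kN]; first exact: XxN.
  exact: (Xu (Ordinal (kN : (k.+1 < N.+1)%N))).
- by rewrite nominal_rcons ?su// -nominal_cons nth_rcons su ltnn eqxx.
Qed.

(** The new stage cost [ell xN b] is paid for by the decrease of the terminal
    cost, so that the removed first stage cost is a net gain. *)
Lemma nominal_cost_shift : Vf (f xN b) <= Vf xN - ell xN b ->
  nominal_cost f ell Vf (f x a) [tuple of rcons u b] <=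
  nominal_cost f ell Vf x [tuple of a :: u] - ell x a.
Proof.
have su := size_tuple u => Vle.
rewrite /nominal_cost big_ord_recr big_ord_recl/=.
rewrite !nominal_rcons ?su// -!nominal_cons !nth_rcons su ltnn eqxx -/xN.
under eq_bigr => i _ do
  rewrite nominal_rcons ?su 1?ltnW// -nominal_cons nth_rcons su ltn_ord.
(* the two sums of the common stages are convertible term by term *)
rewrite [X in _ <= _ + X + _ - _]
  (_ : _ = \sum_(i < N) ell (nominal f (a :: u) i.+1 x) u`_i)//.
have -> : f (nominal f (a :: u) N x) (a :: u)`_N = xN by [].
move: Vle; set S := \sum_(i < N) _; lra.
Qed.

End Terminal.
End Shift.

(** * Compactness of the admissible plans *)

(** The dynamics and the stage cost are continuous only relative to the input
    constraint set, so limits can be composed with them only along maps that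
    stay in that set. *)
Lemma cvg_comp_within (T : Type) (S W : topologicalType) (F : set_system T)
    (A : set S) (g : T -> S) (h : S -> W) (y : S) : Filter F ->
  g @ F --> y -> (\forall t \near F, A (g t)) -> h @ within A (nbhs y) --> h y ->
  h (g t) @[t --> F] --> h y.
Proof.
move=> FF gy gA hy; apply: (@cvg_comp _ _ _ g h _ (within A (nbhs y))) => // B.
by rewrite /within/= => /gy /=; move: gA; apply: filterS2 => t At; exact.
Qed.

(** Matrices over an arbitrary topological space are needed because a row
    whose entries are input vectors represents an input sequence. *)
Lemma entry_continuous (T : topologicalType) (m n : nat) (i : 'I_m) (j : 'I_n) :
  continuous (fun M : 'M[T]_(m, n) => M i j).
Proof.
move=> M A MA.
exists (fun i' j' => [set a | i' = i -> j' = j -> A a]) => [i' j'|M' AM'].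
  have [->|ne] := eqVneq i' i; last by apply: filterE => a /= /eqP; rewrite (negPf ne).
  have [->|ne] := eqVneq j' j; last by apply: filterE => a /= _ /eqP; rewrite (negPf ne).
  by move: MA; apply: filterS => a Aa.
exact: (AM' i j).
Qed.

Section Compactness.
Variables (R : realType) (n m N : nat).
Variables (f : 'cV[R]_n -> 'cV[R]_m -> 'cV[R]_n) (ell : 'cV[R]_n -> 'cV[R]_m -> R).
Variables (U : set 'cV[R]_m) (X Xf : set 'cV[R]_n).
Variables (Vf : 'cV[R]_n -> R) (Vd : 'cV[R]_n -> 'cV[R]_n -> R).

Local Notation plan := ('cV[R]_n * 'rV['cV[R]_m]_N)%type.
Local Notation continuous_on_U h :=
  {within [set z : 'cV[R]_n * 'cV[R]_m | U z.2],
    continuous (fun z => h z.1 z.2)}.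
Implicit Types (p q : plan) (k : nat).

(** Tuples carry no topology, so an input sequence is represented by a row of
    input vectors, to which the product theorem [rV_compact] applies. *)
Definition inputs p : N.-tuple 'cV[R]_m := [tuple p.2 0 i | i < N].

Definition U_plans : set plan := [set p : plan | forall i, U (p.2 0 i)].

Definition admissible_plans : set plan :=
  [set p | admissible f U X Xf p.1 (inputs p)].

Lemma nth_inputs p (i : 'I_N) : (inputs p)`_i = p.2 0 i.
Proof. by rewrite -tnth_nth tnth_mktuple. Qed.

Lemma inputs_surj x (u : N.-tuple 'cV[R]_m) : inputs (x, \row_i tnth u i) = u.
Proof. by apply: eq_from_tnth => i; rewrite tnth_mktuple mxE. Qed.

Lemma admissible_plans_U p : admissible_plans p -> U_plans p.
Proof. by move=> [Up _ _] i; rewrite -nth_inputs. Qed.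

Lemma cvg_input p (i : 'I_N) :
  (inputs q)`_i @[q --> within U_plans (nbhs p)] --> (inputs p)`_i.
Proof.
apply: cvg_within_filter; rewrite nth_inputs.
under eq_cvg do rewrite nth_inputs.
apply: (@cvg_comp _ _ _ (fun q : plan => q.2) (fun M => M 0 i) _ (nbhs p.2)).
  exact: cvg_snd.
exact: entry_continuous.
Qed.

Hypothesis f_cont : continuous_on_U f.

(** One step of an induction along the trajectory, for [h] the dynamics or the
    stage cost. *)
Lemma cvg_along (W : topologicalType) (h : 'cV[R]_n -> 'cV[R]_m -> W)
    (g : plan -> 'cV[R]_n) p (i : 'I_N) :
  continuous_on_U h ->
  U_plans p -> g @ within U_plans (nbhs p) --> g p ->
  h (g q) (inputs q)`_i @[q --> within U_plans (nbhs p)] -->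
    h (g p) (inputs p)`_i.
Proof.
move=> /subspace_continuousP h_cont Up gp.
apply: (@cvg_comp_within _ _ _ _ [set z : 'cV[R]_n * 'cV[R]_m | U z.2]
  (fun q => (g q, (inputs q)`_i)) (fun z => h z.1 z.2) (g p, (inputs p)`_i)).
- exact: cvg_pair gp (@cvg_input p i).
- rewrite near_withinE; apply: nearW => q Uq /=; rewrite nth_inputs.
  exact: Uq.
- by apply: h_cont => /=; rewrite nth_inputs; exact: Up.
Qed.

Lemma nominal_cvg p k : U_plans p -> (k <= N)%N ->
  nominal f (inputs q) k q.1 @[q --> within U_plans (nbhs p)] -->
    nominal f (inputs p) k p.1.
Proof.
move=> Up; elim: k => [_|k IH kN].
  by apply: cvg_within_filter; exact: cvg_fst.
exact: (@cvg_along _ f (fun q => nominal f (inputs q) k q.1) p (Ordinal kN)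
  f_cont Up (IH (ltnW kN))).
Qed.

Hypothesis ell_cont : continuous_on_U ell.
Hypothesis Vf_cont : continuous Vf.

Lemma nominal_cost_continuous :
  {within admissible_plans,
    continuous (fun p => nominal_cost f ell Vf p.1 (inputs p))}.
Proof.
apply: (@continuous_subspaceW _ _ _ U_plans); first exact: admissible_plans_U.
apply/subspace_continuousP => p Up; apply: cvgD.
- apply: cvg_big => [|i _]; first exact: add_continuous.
  apply: (@cvg_along _ ell (fun q => nominal f (inputs q) i q.1)) => //.
  exact: nominal_cvg (ltnW (ltn_ord i)).
- apply: (@cvg_comp _ _ _ (fun q => nominal f (inputs q) N q.1) Vf).
    exact: nominal_cvg.
  exact: Vf_cont.
Qed.

Lemma slack_cost_continuous (lambda : R) (x : 'cV[R]_n) :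
  continuous (Vd x) ->
  {within admissible_plans,
    continuous (fun p => slack_cost f ell Vf Vd lambda x p.1 (inputs p))}.
Proof.
move=> Vd_cont.
apply: (within_continuousD nominal_cost_continuous).
apply: continuous_subspaceT => p; apply: cvgMr.
apply: (@cvg_comp _ _ _ (fun q : plan => q.1) (Vd x) _ (nbhs p.1)).
  exact: cvg_fst.
exact: Vd_cont.
Qed.

Hypotheses (X_closed : closed X) (Xf_closed : closed Xf).
Hypotheses (U_compact : compact U).
Hypothesis feasible_compact : compact (feasible_set f U X N Xf).

(** Admissible plans lie in the product of the compact feasible set with the
    compact set of input sequences; a cluster point there satisfies the state
    and terminal constraints because the trajectories depend continuously on
    the plan and the constraint sets are closed. *)
Lemma admissible_plans_compact : compact admissible_plans.
Proof.
have inputs_compact := rV_compact (fun=> U_compact) : compact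
  [set v : 'rV['cV[R]_m]_N | forall i, U (v 0 i)].
move=> F FF FK.
have [|p [[_ /= Up] pF]] := compact_setX feasible_compact inputs_compact FF.
  move: FK; apply: filterS => q Kq; split; first by exists (inputs q).
  exact: admissible_plans_U.
exists p; split => //.
(* a cluster point of a filter on a set is in its closure, which is what
   lets limits be taken along that set *)
have clK : closure admissible_plans p by move=> B /(pF _ _ FK).
have near_mem (Y : set 'cV[R]_n) k : closed Y -> (k <= N)%N ->
    (forall q, admissible_plans q -> Y (nominal f (inputs q) k q.1)) ->
    Y (nominal f (inputs p) k p.1).
  move=> Yc kN Yq; have PF := within_nbhs_proper clK.
  apply: (@closed_cvg _ _ (within admissible_plans (nbhs p)) PF
    (fun q => nominal f (inputs q) k q.1) Y Yc).
    by rewrite near_withinE; apply: nearW.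
  apply: cvg_trans (nominal_cvg Up kN).
  by apply: cvg_app; apply: within_subset => //; exact: admissible_plans_U.
split.
- by move=> i; rewrite nth_inputs.
- by move=> k; apply: near_mem => // [|q [_ + _]]; first exact/ltnW.
- by apply: near_mem => // q [].
Qed.

Hypothesis (feasible_nonempty : feasible_set f U X N Xf !=set0).

Lemma admissible_plans_nonempty : admissible_plans !=set0.
Proof.
have [x [u xu]] := feasible_nonempty.
by exists (x, \row_i tnth u i); rewrite /admissible_plans/= inputs_surj.
Qed.

Lemma slack_minimizers_nonempty (lambda : R) (x : 'cV[R]_n) :
  continuous (Vd x) ->
  slack_minimizers f ell U X (N := N) Vf Xf Vd lambda x !=set0.
Proof.
move=> Vd_cont.
have [p /set_mem Kp pmin] := compact_EVT_min admissible_plans_nonempty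
  admissible_plans_compact (slack_cost_continuous (lambda := lambda) Vd_cont).
exists (p.1, inputs p); split => //= z u zu.
have := pmin (z, \row_i tnth u i); rewrite inputs_surj; apply.
by rewrite inE /admissible_plans/= inputs_surj.
Qed.

Lemma nominal_cost_bounded :
  exists J, forall z (u : N.-tuple 'cV[R]_m), admissible f U X Xf z u ->
    nominal_cost f ell Vf z u <= J.
Proof.
have [p _ pmax] := compact_EVT_max admissible_plans_nonempty
  admissible_plans_compact nominal_cost_continuous.
exists (nominal_cost f ell Vf p.1 (inputs p)) => z u zu.
have := pmax (z, \row_i tnth u i); rewrite inputs_surj; apply.
by rewrite inE /admissible_plans/= inputs_surj.
Qed.

End Compactness.

(** * Decrease of the optimal relaxed cost *)

(** The zero input keeps the system at the origin. *)
Lemma feasible_origin (R : realType) (n m N : nat)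
    (f : 'cV[R]_n -> 'cV[R]_m -> 'cV[R]_n) (U : set 'cV[R]_m)
    (X Xf : set 'cV[R]_n) :
  f 0 0 = 0 -> U 0 -> X 0 -> Xf 0 -> feasible_set f U X N Xf 0.
Proof.
move=> f0 U0 X0 Xf0; exists (nseq_tuple N 0).
have nth0 k : (nseq_tuple N (0 : 'cV[R]_m))`_k = 0 by rewrite nth_nseq if_same.
have stay0 k : nominal f (nseq_tuple N 0) k 0 = 0.
  by elim: k => [//|k IH]; rewrite [LHS]/= IH nth0.
by split=> [k|k|]; rewrite ?nth0 ?stay0.
Qed.

Section Decrease.
Variables (R : realType) (n m N : nat).
Variables (f : 'cV[R]_n -> 'cV[R]_m -> 'cV[R]_n) (ell : 'cV[R]_n -> 'cV[R]_m -> R).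
Variables (U : set 'cV[R]_m) (X Xf : set 'cV[R]_n).
Variables (Vf : 'cV[R]_n -> R) (Vd : 'cV[R]_n -> 'cV[R]_n -> R).
Variables (kf : 'cV[R]_n -> 'cV[R]_m) (c3 c4 lambda : R).
Hypotheses (N_gt0 : (0 < N)%N) (lambda_gt0 : 0 < lambda) (c3_gt0 : 0 < c3).
Hypothesis ell_ge0 : forall x u, U u -> 0 <= ell x u.
Hypothesis Xf_X : Xf `<=` X.
Hypothesis kf_law : forall x, Xf x ->
  [/\ U (kf x), Xf (f x (kf x)) & Vf (f x (kf x)) <= Vf x - ell x (kf x)].
Hypothesis Vd_decrease : forall x z w u, U u ->
  Vd (f x u + w) (f z u) - Vd x z <=
    - (c3 * enorm (x - z) ^+ 2) + c4 * enorm w ^+ 2.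

Local Notation minimizers x :=
  (slack_minimizers f ell U X (N := N) Vf Xf Vd lambda x).
Local Notation cost x p := (slack_cost f ell Vf Vd lambda x p.1 p.2).

(** The minimizer [q] at the successor is compared with the shift of the
    minimizer [p].  The violation at [x] is measured against the first nominal
    state of [p], which lies in [X]. *)
Lemma slack_cost_decrease (x w : 'cV[R]_n) p q :
  minimizers x p -> minimizers (f x p.2`_0 + w) q ->
  cost (f x p.2`_0 + w) q <=
    cost x p - lambda * (c3 * set_dist X x ^+ 2) + lambda * (c4 * enorm w ^+ 2).
Proof.
case: N N_gt0 p q => // N' _ [z v] q /= [/= + _] [_ qmin].
case/tupleP: v qmin => a u /= qmin zu; have [Uu Xu XfN] := zu.
have Ua : U a := Uu ord0.
have [Ub Xfb Vfb] := kf_law XfN.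
apply: le_trans (qmin _ _ (admissible_shift zu (Xf_X XfN) Ub Xfb)) _.
have costle := nominal_cost_shift Vfb.
have Vdle := Vd_decrease x z w Ua.
have distle : set_dist X x ^+ 2 <= enorm (x - z) ^+ 2.
  rewrite ler_sqr ?nnegrE ?set_dist_ge0 ?enorm_ge0//.
  exact: set_dist_le (Xu ord0).
have {}distle : c3 * set_dist X x ^+ 2 <= c3 * enorm (x - z) ^+ 2.
  by rewrite ler_pM2l.
rewrite /slack_cost.
have : lambda * Vd (f x a + w) (f z a) <= lambda *
    (Vd x z - c3 * set_dist X x ^+ 2 + c4 * enorm w ^+ 2).
  by rewrite ler_pM2l//; lra.
rewrite !mulrDr mulrN; have := ell_ge0 z Ua; move: costle => /=; lra.
Qed.

(** The minimizer at the current state is arbitrary, because minimizers need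
    not be unique and the policy may pick another one; its cost is the same.
    At the initial state any admissible plan serves as a competitor. *)
Lemma slack_cost_telescope (mpc : 'cV[R]_n -> 'cV[R]_m)
    (w x : nat -> 'cV[R]_n) (T : nat) z (u : N.-tuple 'cV[R]_m) p :
  slack_policy f ell U X N Vf Xf Vd lambda mpc ->
  (forall y, minimizers y !=set0) ->
  (forall k, x k.+1 = f (x k) (mpc (x k)) + w k) ->
  admissible f U X Xf z u -> minimizers (x T) p ->
  cost (x T) p + lambda * (c3 * \sum_(0 <= k < T) set_dist X (x k) ^+ 2) <=
    slack_cost f ell Vf Vd lambda (x 0%N) z u
    + lambda * (c4 * \sum_(0 <= k < T) enorm (w k) ^+ 2).
Proof.
move=> policy min_ex xS zu; elim: T p => [p [_ pmin]|T IH q qmin].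
  by rewrite !big_geq// !mulr0 !addr0; exact: pmin.
have [p pmin mpcp] := policy _ (min_ex (x T)).
rewrite !big_nat_recr//= !mulrDr; have := IH p pmin.
rewrite xS mpcp in qmin *.
by have := slack_cost_decrease pmin qmin; lra.
Qed.

End Decrease.

Theorem theorem2 (R : realType) (n m N : nat)
  (f : 'cV[R]_n -> 'cV[R]_m -> 'cV[R]_n) (ell : 'cV[R]_n -> 'cV[R]_m -> R)
  (U : set 'cV[R]_m) (X Xf : set 'cV[R]_n) (Vf : 'cV[R]_n -> R)
  (Vd : 'cV[R]_n -> 'cV[R]_n -> R)
  (al af a1 a2 a3 a4 : R -> R) (Q : 'M[R]_n) (P : 'M[R]_m)
  (hN : (1 <= N)%N)
  (hell : forall x u, U u -> 0 <= ell x u)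
  (hX : closed X)
  (hVf : forall x, 0 <= Vf x) (hVf_cont : continuous Vf)
  (hXf_sub : Xf `<=` X) (hXf : closed Xf)
  (hreg : regularity f ell U X al)
  (hterm : terminal_conditions f ell U X N Vf Xf af)
  (hols : open_loop_stability f U Vd a1 a2 a3 a4)
  (hquad_al : is_quadratic al) (hquad_af : is_quadratic af)
  (hQ : posdef Q) (hP : posdef P)
  (hell_quad : forall x u, U u -> ell x u = wnorm Q x ^+ 2 + wnorm P u ^+ 2)
  (hquad_1 : is_quadratic a1) (hquad_2 : is_quadratic a2)
  (hquad_3 : is_quadratic a3) (hquad_4 : is_quadratic a4) :
  exists c1 c2 c3 : R,
    [/\ 0 <= c1, 0 <= c2, 0 <= c3 &
      forall (x0 : 'cV[R]_n) (lambda : R), 0 < lambda ->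
      forall mpc : 'cV[R]_n -> 'cV[R]_m,
        slack_policy f ell U X N Vf Xf Vd lambda mpc ->
      forall (w : nat -> 'cV[R]_n) (T : nat) (x : nat -> 'cV[R]_n),
        closed_loop f mpc w x0 x ->
        \sum_(0 <= k < T) set_dist X (x k) ^+ 2 <=
          c1 * set_dist (feasible_set f U X N Xf) x0 ^+ 2 + c2 / lambda
          + c3 * \sum_(0 <= k < T) enorm (w k) ^+ 2].
Proof.
have [c2 c2_gt0 a2E] := Kinf_quadratic (ols_Kinf2 hols) hquad_2.
have [c3 c3_gt0 a3E] := Kinf_quadratic (ols_Kinf3 hols) hquad_3.
have [c4 c4_gt0 a4E] := Kinf_quadratic (ols_Kinf4 hols) hquad_4.
have [kf kf_law] := term_law hterm.
have Xf0 : Xf 0 := interior_subset (term_int hterm).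
have X_N0 : feasible_set f U X N Xf !=set0.
  exists 0; apply: feasible_origin => //; first exact: reg_f0 hreg.
    exact: interior_subset (reg_U0 hreg).
  exact: hXf_sub.
have [J J_ub] := nominal_cost_bounded (reg_f_cont hreg) (reg_ell_cont hreg)
  hVf_cont hX hXf (reg_U_compact hreg) (term_compact hterm) X_N0.
have nominal_cost_ge0 z (u : N.-tuple 'cV[R]_m) : admissible f U X Xf z u ->
    0 <= nominal_cost f ell Vf z u.
  by move=> [Uu _ _]; apply: addr_ge0 => //; apply: sumr_ge0 => k _; exact: hell.
have J_ge0 : 0 <= J.
  have [z [u zu]] := X_N0; exact: le_trans (nominal_cost_ge0 _ _ zu) (J_ub _ _ zu).
exists (c2 / c3), (J / c3), (c4 / c3).
split; rewrite ?divr_ge0 ?(ltW c2_gt0) ?(ltW c3_gt0) ?(ltW c4_gt0)//.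
move=> x0 lambda lambda_gt0 mpc policy w T x [x0E xS].
have Vd_cont y : continuous (Vd y).
  move=> z; apply: (@cvg_comp _ _ _ (fun s => (y, s)) (fun p => Vd p.1 p.2) _
    (nbhs (y, z))).
    apply: (@cvg_pair _ _ _ (nbhs z) (nbhs y) (nbhs z) _ _ _ (fun=> y) id).
      exact: cvg_cst.
    exact: cvg_id.
  by have /(_ (y, z)) := ols_cont hols.
have min_ex y :
    slack_minimizers f ell U X (N := N) Vf Xf Vd lambda y !=set0.
  exact: (slack_minimizers_nonempty (reg_f_cont hreg) (reg_ell_cont hreg)
    hVf_cont hX hXf (reg_U_compact hreg) (term_compact hterm) X_N0 lambda
    (Vd_cont y)).
have [p pmin] := min_ex (x T).
have law y : Xf y ->
    [/\ U (kf y), Xf (f y (kf y)) & Vf (f y (kf y)) <= Vf y - ell y (kf y)].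
  by move=> /kf_law[? [_ ?] ? _].
have Vd_decrease y z v u : U u -> Vd (f y u + v) (f z u) - Vd y z <=
    - (c3 * enorm (y - z) ^+ 2) + c4 * enorm v ^+ 2.
  by move=> Uu; rewrite -a3E ?enorm_ge0// -a4E ?enorm_ge0// (ols_decrease hols).
set D := \sum_(0 <= k < T) _; set W := \sum_(0 <= k < T) _.
have cost_ge0 : 0 <= slack_cost f ell Vf Vd lambda (x T) p.1 p.2.
  apply: addr_ge0; first by apply: nominal_cost_ge0; case: pmin.
  by rewrite mulr_ge0 ?(ltW lambda_gt0)//; exact: (ols_ge0 hols).
have near_bound s : feasible_set f U X N Xf s ->
    lambda * (c3 * D) - lambda * (c4 * W) <=
      J + (lambda * c2) * enorm (x0 - s) ^+ 2.
  move=> [u su].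
  have := slack_cost_telescope hN lambda_gt0 c3_gt0 hell hXf_sub law
    Vd_decrease policy min_ex xS su pmin.
  have /andP[_] := ols_bounds hols x0 s; rewrite a2E ?enorm_ge0//.
  rewrite -(ler_pM2l lambda_gt0) mulrA {2}/slack_cost x0E -/D -/W.
  have := J_ub _ _ su; move: cost_ge0; lra.
have := le_set_dist_sqr X_N0 (mulr_gt0 lambda_gt0 c2_gt0) near_bound.
set d := set_dist _ x0 => bound.
(* clearing the denominators lambda and c3 recovers the telescoped bound *)
rewrite -(ler_pM2l (mulr_gt0 lambda_gt0 c3_gt0)).
have -> : lambda * c3 * (c2 / c3 * d ^+ 2 + J / c3 / lambda + c4 / c3 * W) =
    lambda * c2 * d ^+ 2 + J + lambda * (c4 * W).
  by field; rewrite !gt_eqF.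
by move: bound; rewrite -mulrA; lra.
Qed.
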